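(* Let $n\geq 2$ be an integer, let $k\geq 1$ be real, let $P(z)=\sum_{j=0}^{n}a_jz^j$ be a complex polynomial of degree $n$ all of whose zeros lie in $|z|\leq k$, and let $m=\min_{|z|=k}|P(z)|$. Then for every real $l$ with $0\leq l<1$, $$\max_{|z|=1}|P'(z)|\geq \frac{n}{1+k^n}\left(\max_{|z|=1}|P(z)|+lm\right)+\psi(k)|a_1|+\frac{1}{k^n(1+k^n)}\left\{\left(\frac{k^n|a_n|-lm-|a_0|}{k^n|a_n|-lm+|a_0|}\right)\left(k^n\max_{|z|=1}|P(z)|-lm\right)+k^{n-1}|a_{n-1}|\phi(k)\left(n+\frac{k^n|a_n|-lm-|a_0|}{k^n|a_n|-lm+|a_0|}\right)\right\},$$ where $\phi(k)=\frac{k^{n}-1}{n}-\frac{k^{n-2}-1}{n-2}$ and $\psi(k)=1-\frac{1}{k^2}$ if $n>2$, while $\phi(k)=\frac{(k-1)^2}{2}$ and $\psi(k)=1-\frac{1}{k}$ if $n=2$. The result is sharp: equality holds for $P(z)=z^n+k^n$.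
   Context: Polynomials are in one complex variable with complex coefficients; $P$ of degree $n$ means $a_n\neq 0$. *)

(* Defs.v *)
From HB Require Import structures.
From mathcomp Require Import all_boot all_order all_algebra.
From mathcomp Require Import complex.
From mathcomp Require Import all_classical all_reals all_analysis.

Set Implicit Arguments.
Unset Strict Implicit.
Unset Printing Implicit Defensive.

Import Order.TTheory GRing.Theory Num.Theory numFieldNormedType.Exports.

Local Open Scope classical_set_scope.
Local Open Scope ring_scope.
Local Open Scope complex_scope.

(* The modulus in R itself (`|z| lives in R[i]); see normc_def. *)
Notation cmod := (@ComplexField.Normc.normc _).

Definition circle_moduli (R : realType) (r : R) (p : {poly R[i]}) : set R :=
  [set cmod p.[z] | z in [set z : R[i] | cmod z = r]].

(* For 0 <= r the sup and inf below are attained: maxmodP, minmodP. *)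
Definition maxmod (R : realType) (r : R) (p : {poly R[i]}) : R :=
  sup (circle_moduli r p).

Definition minmod (R : realType) (r : R) (p : {poly R[i]}) : R :=
  inf (circle_moduli r p).

Definition zeros_in_disk (R : realType) (k : R) (p : {poly R[i]}) : Prop :=
  forall z : R[i], root p z -> cmod z <= k.

(* In phi, n is at least 2; the natural-number subtraction n - 2 is then exact
   and the denominator n - 2 is nonzero in the branch where it occurs. *)
Definition phi (R : realType) (n : nat) (k : R) : R :=
  if (2 < n)%N then
    (k ^+ n - 1) / n%:R - (k ^+ (n - 2) - 1) / (n - 2)%:R
  else (k - 1) ^+ 2 / 2.

Definition psi (R : realType) (n : nat) (k : R) : R :=
  if (2 < n)%N then 1 - 1 / k ^+ 2 else 1 - 1 / k.

Definition coef_ratio (R : realType) (n : nat) (k l : R) (P : {poly R[i]}) : R :=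
  let m := minmod k P in
  (k ^+ n * cmod P`_n - l * m - cmod P`_0)
  / (k ^+ n * cmod P`_n - l * m + cmod P`_0).

Definition deriv_bound (R : realType) (n : nat) (k l : R) (P : {poly R[i]}) : R :=
  let m := minmod k P in
  let M := maxmod 1 P in
  n%:R / (1 + k ^+ n) * (M + l * m)
  + psi n k * cmod P`_1
  + 1 / (k ^+ n * (1 + k ^+ n))
    * (coef_ratio n k l P * (k ^+ n * M - l * m)
       + k ^+ (n - 1) * cmod P`_(n - 1) * phi n k
         * (n%:R + coef_ratio n k l P)).

Section Attained.
Variable R : realType.
Implicit Types (r t : R) (p : {poly R[i]}) (z : R[i]).

Let pt r t : R[i] := (r * cos t) +i* (r * sin t).

Let cmod_pt r t : 0 <= r -> cmod (pt r t) = r.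
Proof.
move=> r0; rewrite /= !exprMn -mulrDr cos2Dsin2 mulr1 sqrtr_sqr ger0_norm //.
Qed.

Let pt_surj z : exists2 t, t \in `[- pi, pi]%R & z = pt (cmod z) t.
Proof.
case: z => x y; set r := cmod _.
have r0 : 0 <= r by rewrite sqrtr_ge0.
have rE : r ^+ 2 = x ^+ 2 + y ^+ 2 by rewrite sqr_sqrtr // addr_ge0 ?sqr_ge0.
have pi0 := pi_ge0 R.
have [r00|rn0] := eqVneq r 0.
  exists 0; first by rewrite in_itv /= oppr_le0 pi0.
  move/eqP: rE; rewrite r00 expr0n /= eq_sym paddr_eq0 ?sqr_ge0 //.
  by rewrite !sqrf_eq0 => /andP[/eqP-> /eqP->]; rewrite /pt !mul0r.
have rp : 0 < r by rewrite lt_neqAle eq_sym rn0.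
have xr : -1 <= x / r <= 1.
  rewrite -ler_norml normrM normfV (gtr0_norm rp) ler_pdivrMr // mul1r.
  rewrite -(ger0_norm r0) -ler_sqr ?nnegrE ?normr_ge0 // !real_normK ?num_real // rE.
  by rewrite lerDl sqr_ge0.
have xE : r * (x / r) = x by rewrite mulrC divfK.
have yE : r * Num.sqrt (1 - (x / r) ^+ 2) = `|y|.
  rewrite -[X in X * _](ger0_norm r0) -sqrtr_sqr -sqrtrM ?sqr_ge0 //.
  by rewrite mulrBr mulr1 -exprMn xE rE addrC addKr sqrtr_sqr.
have a0 := acos_ge0 xr; have api := acos_lepi xr.
have [y0|y0] := leP 0 y.
  exists (acos (x / r)).
    by rewrite in_itv /= api andbT (le_trans _ a0) // oppr_le0.
  by rewrite /pt sin_acos // acosK ?xE ?yE ?in_itv //= ger0_norm.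
exists (- acos (x / r)).
  by rewrite in_itv /= lerN2 api /= (le_trans _ pi0) // oppr_le0.
by rewrite /pt cosN sinN sin_acos // acosK ?in_itv // xE mulrN yE ltr0_norm // opprK.
Qed.

Let cont_horner r p :
  continuous (fun t => complex.Re p.[pt r t]) /\
  continuous (fun t => complex.Im p.[pt r t]).
Proof.
elim/poly_ind: p => [|p c [cRe cIm]].
  by split=> t; under eq_fun do rewrite horner0 /=; exact: cvg_cst.
have cc : continuous (fun t => r * cos t).
  by move=> t; apply: cvgM; [exact: cvg_cst|exact: continuous_cos].
have cs : continuous (fun t => r * sin t).
  by move=> t; apply: cvgM; [exact: cvg_cst|exact: continuous_sin].
split=> t.
  rewrite (_ : (fun _ => _) = (fun t => complex.Re p.[pt r t] * (r * cos t)
     - complex.Im p.[pt r t] * (r * sin t) + complex.Re c)); last first.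
    by apply/funext => u; rewrite hornerMXaddC; case: p.[_] => a b; case: c.
  apply: cvgD; last exact: cvg_cst.
  by apply: cvgB; apply: cvgM; [exact: cRe|exact: cc|exact: cIm|exact: cs].
rewrite (_ : (fun _ => _) = (fun t => complex.Re p.[pt r t] * (r * sin t)
   + complex.Im p.[pt r t] * (r * cos t) + complex.Im c)); last first.
  by apply/funext => u; rewrite hornerMXaddC; case: p.[_] => a b; case: c.
apply: cvgD; last exact: cvg_cst.
by apply: cvgD; apply: cvgM; [exact: cRe|exact: cs|exact: cIm|exact: cc].
Qed.

Let cont_cmod r p : continuous (fun t => cmod p.[pt r t]).
Proof.
have [cRe cIm] := cont_horner r p.
pose f t := complex.Re p.[pt r t] * complex.Re p.[pt r t]
  + complex.Im p.[pt r t] * complex.Im p.[pt r t].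
rewrite (_ : (fun _ => _) = @Num.sqrt R \o f); last first.
  by apply/funext => t; rewrite /f /=; case: p.[_].
move=> t; apply: continuous_comp; last exact: sqrt_continuous.
by apply: cvgD; apply: cvgM; [exact: cRe|exact: cRe|exact: cIm|exact: cIm].
Qed.

Lemma maxmodP r p : 0 <= r ->
  circle_moduli r p (maxmod r p) /\
  forall z, cmod z = r -> cmod p.[z] <= maxmod r p.
Proof.
move=> r0.
have [||c _ cmax] := @EVT_max R (fun t => cmod p.[pt r t]) (- pi) pi.
- by rewrite ge0_cp // pi_ge0.
- exact/continuous_subspaceT/cont_cmod.
have ub : ubound (circle_moduli r p) (cmod p.[pt r c]).
  by move=> _ [z zr <-]; have [t tI ->] := pt_surj z; rewrite zr; exact: cmax.
have mem : circle_moduli r p (cmod p.[pt r c]).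
  by exists (pt r c) => //; exact: cmod_pt.
have -> : maxmod r p = cmod p.[pt r c].
  apply/eqP; rewrite eq_le ge_sup //=; last by exists (cmod p.[pt r c]).
  by apply: ub_le_sup => //; exists (cmod p.[pt r c]).
by split=> // z zr; apply: ub; exists z.
Qed.

Lemma minmodP r p : 0 <= r ->
  circle_moduli r p (minmod r p) /\
  forall z, cmod z = r -> minmod r p <= cmod p.[z].
Proof.
move=> r0.
have [||c _ cmin] := @EVT_min R (fun t => cmod p.[pt r t]) (- pi) pi.
- by rewrite ge0_cp // pi_ge0.
- exact/continuous_subspaceT/cont_cmod.
have lb : lbound (circle_moduli r p) (cmod p.[pt r c]).
  by move=> _ [z zr <-]; have [t tI ->] := pt_surj z; rewrite zr; exact: cmin.
have mem : circle_moduli r p (cmod p.[pt r c]).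
  by exists (pt r c) => //; exact: cmod_pt.
have -> : minmod r p = cmod p.[pt r c].
  apply/eqP; rewrite eq_le lb_le_inf ?andbT //; last by exists (cmod p.[pt r c]).
  by apply: ge_inf => //; exists (cmod p.[pt r c]).
by split=> // z zr; apply: lb; exists z.
Qed.

End Attained.

(* Main.v *)
Require Import Defs.
From mathcomp Require Import all_boot all_order all_algebra.
From mathcomp Require Import complex polyrcf separable.
From mathcomp Require Import all_classical all_reals all_analysis.
From mathcomp Require Import ring lra.

(** Why the theorem holds. Let G(z) = P(kz) and let q(z) = z^n conj(G(1 / conj z)) be its
    reversal. Then q has no zero in |z| < 1, its moduli on |z| = 1 are those of P on
    |z| = k, and |q(kz)| = k^n |P(z)| for |z| = 1. Write mu and m for the maximum and
    the minimum of |P| on |z| = k, M for the maximum of |P| on |z| = 1, K = k^n and t = l m.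
    For |z| = 1 the codifferential n q(z) - z q'(z) has modulus |G'(z)| = k |P'(kz)|.

    Lower bound on |P'| at a point of |z| = k where |P| = mu. For |z| = 1 <= |w| the real
    part of z / (z - w) is at most 1 / (1 + |w|); summing over the zeros w of q, and merging
    the terms 1 / (1 + |w|) two by two into a term depending on the product of the |w| only,
    gives |n q - z q'| >= (n + s) / 2 |q| with s = (|q_0| - |q_n|) / (|q_0| + |q_n|)
    ([turan_codiff]). By the minimum modulus principle q + c still has no zero in the disk
    when |c| = t, and choosing the phase of c gives
    |n q - z q'| >= n t + (n + s) / 2 (|q| - t), now with |q_0| - t in place of |q_0| in s
    ([turan_codiff_min]).

    Upper bound on |P'| on |z| = k by its maximum on |z| = 1. If |p| <= M on the unit circle
    and p has degree at most n, where n >= 2, then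
    |p(rz)| <= r^n M - (r^n - r^(n-2)) |p_0| ([growth]; in degree 1 the analogue is
    [growth_affine]). For the reversal of p this reads
    |f(w)| + (1 - |w|^2) |f_n| <= M in the disk ([sharp_max_principle]), which holds because
    f(w) + u (1 - |w|^2) f_n is, for every unimodular u, a convex combination of the values
    of f at n points of the circle ([quadrature]). The ordinary maximum principle is a
    special case; the minimum principle follows from it by approximating 1 / q by
    polynomials.

    Lower bound on mu. The Erdos-Lax inequality with minimum modulus,
    |q'| <= n (mu - m) / 2 on the circle ([erdos_lax_min]), combined with the same growth estimate
    for q' and integrated along a ray from the unit circle to |z| = k gives
    K M <= mu + (K - 1) (mu - m) / 2 - phi(k) k^(n-1) |a_(n-1)| ([growth_phi]).

    The three bounds combine linearly to the claim ([bound_combination]). For z^n + k^n one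
    has m = s = a_1 = a_(n-1) = 0, and both sides equal n. *)

Set Implicit Arguments.
Unset Strict Implicit.
Unset Printing Implicit Defensive.

Import Order.TTheory GRing.Theory Num.Theory.
Local Open Scope ring_scope.
Local Open Scope complex_scope.

(* Last opened, so that the postfix star is Num.conj wherever it occurs below. *)
Local Open Scope ring_scope.

(** * The modulus *)

Section Modulus.
Variable R : rcfType.
Implicit Types z w : R[i].

Lemma cmod_ge0 z : 0 <= cmod z.
Proof. by case: z => a b; exact: sqrtr_ge0. Qed.

Lemma cmodE z : (cmod z)%:C = `|z|.
Proof. by case: z. Qed.

Lemma cmodM z w : cmod (z * w) = cmod z * cmod w.
Proof. exact: ComplexField.Normc.normcM. Qed.

Lemma cmodV z : cmod z^-1 = (cmod z)^-1.
Proof. exact: ComplexField.Normc.normcV. Qed.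

Lemma cmodX z n : cmod (z ^+ n) = cmod z ^+ n.
Proof.
elim: n => [|n IH]; first by rewrite !expr0 ComplexField.Normc.normc1.
by rewrite !exprS cmodM IH.
Qed.

Lemma cmodD z w : cmod (z + w) <= cmod z + cmod w.
Proof. exact: le_normcD. Qed.

Lemma cmodN z : cmod (- z) = cmod z.
Proof. exact: normcN. Qed.

Lemma cmod_sub z w : cmod z - cmod w <= cmod (z - w).
Proof. by rewrite lerBlDr -{1}(subrK w z) cmodD. Qed.

Lemma cmod_subD z w : cmod z - cmod w <= cmod (z + w).
Proof. by rewrite -(cmodN w) -{2}(opprK w) cmod_sub. Qed.

Lemma cmodJ z : cmod z^* = cmod z.
Proof. by case: z => a b; rewrite -[_^*]/(a -i* b) /= sqrrN. Qed.

Lemma cmod_real (x : R) : cmod x%:C = `|x|.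
Proof. by rewrite /= expr0n addr0 sqrtr_sqr. Qed.

Lemma cmod_nat n : cmod (n%:R : R[i]) = n%:R.
Proof. by rewrite -(rmorph_nat (real_complex R)) cmod_real normr_nat. Qed.

Lemma cmod0 : cmod (0 : R[i]) = 0.
Proof. exact: ComplexField.Normc.normc0. Qed.

Lemma cmod1 : cmod (1 : R[i]) = 1.
Proof. exact: ComplexField.Normc.normc1. Qed.

Lemma cmod_eq0 z : (cmod z == 0) = (z == 0).
Proof.
by apply/eqP/eqP => [/ComplexField.Normc.eq0_normc //|->]; rewrite cmod0.
Qed.

Lemma cmod_gt0 z : (0 < cmod z) = (z != 0).
Proof. by rewrite lt_def cmod_ge0 andbT cmod_eq0. Qed.

Lemma mulcJ z : z * z^* = (cmod z ^+ 2)%:C.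
Proof. by rewrite rmorphXn /= cmodE sqr_normc. Qed.

Lemma sqr_cmod z : cmod z ^+ 2 = complex.Re z ^+ 2 + complex.Im z ^+ 2.
Proof. by case: z => a b; rewrite sqr_sqrtr // addr_ge0 ?sqr_ge0. Qed.

Lemma Re_le_cmod z : complex.Re z <= cmod z.
Proof.
case: z => a b /=; apply: le_trans (ler_norm a) _.
by rewrite -sqrtr_sqr ler_wsqrtr // lerDl sqr_ge0.
Qed.

Lemma cmod_sum (I : Type) (s : seq I) (F : I -> R[i]) :
  cmod (\sum_(i <- s) F i) <= \sum_(i <- s) cmod (F i).
Proof.
elim: s => [|i s IH]; first by rewrite !big_nil cmod0.
by rewrite !big_cons (le_trans (cmodD _ _)) // lerD2l.
Qed.

(** Polar form; the phase of 0 is taken to be 1. *)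
Lemma polar z : exists2 u, cmod u = 1 & z = (cmod z)%:C * u.
Proof.
have [->|z0] := eqVneq z 0; first by exists 1; rewrite ?cmod1 // cmod0 mul0r.
have cz0 : cmod z != 0 by rewrite cmod_eq0.
exists (z / (cmod z)%:C).
  by rewrite cmodM cmodV cmod_real ger0_norm ?cmod_ge0 // divff.
rewrite mulrC divfK // -cmod_eq0 cmod_real normr_eq0 //.
Qed.

Lemma unit_invJ z : cmod z = 1 -> z^-1 = z^*.
Proof.
move=> z1; have z0 : z != 0 by rewrite -cmod_gt0 z1.
by apply: (mulfI z0); rewrite divff // mulcJ z1 expr1n.
Qed.

End Modulus.

(** * The logarithmic derivative on the unit circle *)

Section LogDerivative.
Variable R : rcfType.
Implicit Types (z w : R[i]) (p : {poly R[i]}).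

Lemma deriv_horner_roots (s : seq R[i]) (a z : R[i]) : z \notin s ->
  let p := a *: \prod_(w <- s) ('X - w%:P) in
  p^`().[z] = p.[z] * \sum_(w <- s) (z - w)^-1.
Proof.
move=> zs /=; rewrite derivZ !hornerZ -mulrA; congr (_ * _).
elim: s zs => [|w s IH]; first by rewrite !big_nil derivC hornerC mulr0.
rewrite inE negb_or => /andP[zw zs].
rewrite !big_cons derivM !hornerE derivXsubC hornerC IH // mul1r.
have : z - w != 0 by rewrite subr_eq0.
move=> h; field.
by rewrite h.
Qed.

(** The map w |-> z / (z - w) sends |w| >= 1 to a half-plane, and at given |w| the real part
    is largest when w is opposite to z. *)
Lemma Re_halfplane z w : cmod z = 1 -> 1 <= cmod w -> z != w ->
  complex.Re (z / (z - w)) <= (1 + cmod w)^-1.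
Proof.
move=> z1 w1 zw.
have d0 : 0 < cmod (z - w) by rewrite cmod_gt0 subr_eq0.
have := Re_le_cmod (- (z * w^*)); rewrite cmodN cmodM cmodJ z1 mul1r.
have := sqr_cmod z; rewrite z1; have := sqr_cmod w; have := sqr_cmod (z - w).
have x0 : 0 < 1 + cmod w by lra.
set x := cmod w in w1 x0 *; set y := cmod (z - w) in d0 *.
have -> : z / (z - w) = z * (z - w)^* * ((y ^+ 2)^-1)%:C.
  have -> : ((y ^+ 2)^-1)%:C = (z - w)^-1 * ((z - w)^*)^-1.
    by rewrite -invfM mulcJ; exact: (fmorphV (real_complex R)).
  by rewrite mulrACA divff ?mulr1 // conjC_eq0 subr_eq0.
case: z {z1 zw} @y d0 => a b y d0; case: w @x w1 x0 @y d0 => c d x w1 x0 y d0.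
rewrite /= -!/x; set Y := y ^+ 2 => h1 h2 h3 h4.
have Y0 : 0 < Y by rewrite exprn_gt0.
rewrite mulr0 subr0 ler_pdivrMr // [leRHS]mulrC ler_pdivlMr //.
(* after clearing denominators the difference of both sides is this product *)
have := mulr_ge0 (ltac:(lra) : 0 <= x - 1) (ltac:(lra) : 0 <= x + (a * c + b * d)).
nra.
Qed.

Lemma sum_inv1D_le_half (s : seq R) : all (>= 1) s ->
  \sum_(x <- s) (1 + x)^-1 <= (size s)%:R / 2.
Proof.
elim: s => [_|x s IH /= /andP[x1 /IH le]]; first by rewrite big_nil mul0r.
rewrite big_cons -[(size s).+1%:R]natr1 mulrDl addrC lerD // mul1r.
by rewrite lef_pV2 ?posrE; lra.
Qed.

(** In terms of (x - 1) / (x + 1) = 1 - 2 / (1 + x) this is subadditivity with respect to the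
    product on [1, oo[, that is, subadditivity of tanh on [0, oo[. *)
Lemma sum_inv1D_le (s : seq R) : all (>= 1) s ->
  1 <= \prod_(x <- s) x /\
  \sum_(x <- s) (1 + x)^-1 <= ((size s)%:R - 1) / 2 + (1 + \prod_(x <- s) x)^-1.
Proof.
elim: s => [_|x s IH /= /andP[x1 /IH[P1 le]]].
  have : (1 + 1)^-1 = 1 / 2 :> R by field.
  by rewrite !big_nil; split=> //=; lra.
rewrite !big_cons; move: le; set P := \prod_(_ <- s) _ in P1 *; move=> le.
have xP1 : 1 <= x * P by rewrite -[leLHS]mulr1 ler_pM.
split=> //.
suff : (1 + x)^-1 + (1 + P)^-1 <= 2^-1 + (1 + x * P)^-1.
  by rewrite -[(size s).+1%:R]natr1; lra.
have -> : (1 + x)^-1 + (1 + P)^-1 = 2^-1 + (1 + x * P)^-1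
    - ((x - 1) * (P - 1) * (x * P - 1)) / (2 * ((1 + x) * (1 + P) * (1 + x * P))).
  field; rewrite ?gt_eqF //; lra.
rewrite gerBl divr_ge0 // ?mulr_ge0 //; lra.
Qed.

Lemma Re_log_derivative p z : (forall w, root p w -> 1 <= cmod w) ->
  cmod z = 1 -> p.[z] != 0 ->
  exists s : seq R[i], [/\ p = lead_coef p *: \prod_(w <- s) ('X - w%:P),
    forall w, w \in s -> root p w &
    complex.Re (z * p^`().[z] / p.[z]) <= \sum_(w <- s) (1 + cmod w)^-1].
Proof.
move=> rp z1 pz0; have [s sE] := closed_field_poly_normal p.
have p0 : lead_coef p != 0.
  by rewrite lead_coef_eq0; apply: contraNneq pz0 => ->; rewrite horner0.
have rs w : w \in s -> root p w.
  by move=> ws; rewrite sE rootZ // root_prod_XsubC.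
have zs : z \notin s by apply: contra pz0 => /rs /eqP ->.
exists s; split=> //.
rewrite {1}sE deriv_horner_roots // -sE mulrCA mulrAC divff // mul1r mulr_sumr.
elim: s {sE} rs zs => [|w s IH] rs; first by rewrite !big_nil.
rewrite inE negb_or => /andP[zw zs]; rewrite !big_cons raddfD /= lerD //.
  by apply: Re_halfplane => //; apply/rp/rs; rewrite inE eqxx.
by apply: IH => // v vs; apply: rs; rewrite inE vs orbT.
Qed.

(** On the unit circle its modulus is that of the derivative of the reversal of p with respect
    to the formal degree n, see [codiff_recip]; it is used to state inequalities about the
    reversal in terms of p alone. *)
Definition codiff n p z : R[i] := n%:R * p.[z] - z * p^`().[z].

Lemma codiff_horner0 n p z : cmod z = 1 -> p.[z] = 0 ->
  cmod (codiff n p z) = cmod p^`().[z].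
Proof. by move=> z1 pz; rewrite /codiff pz mulr0 sub0r cmodN cmodM z1 mul1r. Qed.

Lemma codiffE n p z : p.[z] != 0 ->
  codiff n p z = p.[z] * (n%:R - z * p^`().[z] / p.[z]).
Proof. by move=> pz; rewrite /codiff; field. Qed.

(** When p has degree n, the product of the moduli of its zeros is |p_0| / |p_n|. When the
    degree is smaller, the missing zeros count as zeros at infinity, the fraction is 1, and
    the crude bound 1 / 2 for each existing zero is enough. *)
Lemma Re_log_derivative_le n p z : (size p <= n.+1)%N ->
  (forall w, root p w -> 1 <= cmod w) -> cmod z = 1 -> p.[z] != 0 ->
  complex.Re (z * p^`().[z] / p.[z]) <=
    n%:R - (n%:R + (cmod p`_0 - cmod p`_n) / (cmod p`_0 + cmod p`_n)) / 2.
Proof.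
move=> sp rp z1 pz0; have [s [sE rs le]] := Re_log_derivative rp z1 pz0.
apply: le_trans le _.
have lp0 : lead_coef p != 0.
  by rewrite lead_coef_eq0; apply: contraNneq pz0 => ->; rewrite horner0.
have p00 : 0 < cmod p`_0.
  rewrite cmod_gt0 -horner_coef0; apply/negP => /rp; rewrite cmod0; lra.
have szp : size p = (size s).+1.
  by rewrite sE size_scale // size_prod_XsubC.
have all1 : all (>= 1) [seq cmod w | w <- s].
  by apply/allP => _ /mapP[w ws ->]; apply/rp/rs.
have [_] := sum_inv1D_le all1; rewrite size_map !big_map => le.
have pos w : 0 < 1 + cmod w by have := cmod_ge0 w; lra.
have [sz|sz] := eqVneq (size s) n; last first.
  have pn : p`_n = 0 by rewrite nth_default // szp ltn_neqAle sz -ltnS -szp.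
  have le1 : \sum_(w <- s) (1 + cmod w)^-1 <= (size s)%:R / 2.
    by have := sum_inv1D_le_half all1; rewrite size_map big_map.
  have : (size s).+1%:R <= n%:R :> R by rewrite ler_nat ltn_neqAle sz -ltnS -szp.
  by rewrite -[_.+1%:R]natr1 pn cmod0 subr0 addr0 divff ?gt_eqF //; lra.
have cprod : cmod (\prod_(w <- s) ('X - w%:P)).[0] = \prod_(w <- s) cmod w.
  elim: (s) => [|w t IH]; first by rewrite !big_nil hornerC cmod1.
  by rewrite !big_cons hornerM cmodM IH !hornerE cmodN.
have p0E : cmod p`_0 = cmod p`_n * \prod_(w <- s) cmod w.
  have -> : p`_n = lead_coef p by rewrite lead_coefE szp sz.
  by rewrite -cprod -horner_coef0 {1}sE hornerZ cmodM.
have pn0 : 0 < cmod p`_n.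
  by rewrite cmod_gt0 -[n]/(n.+1.-1) -sz -szp -lead_coefE.
have -> : (cmod p`_0 - cmod p`_n) / (cmod p`_0 + cmod p`_n) =
    1 - 2 * (1 + \prod_(w <- s) cmod w)^-1.
  rewrite p0E; set Q := \prod_(_ <- _) _ in p0E *.
  have Q0 : 0 < Q by move: p00; rewrite p0E pmulr_rgt0.
  by field; rewrite !gt_eqF //; nra.
by rewrite sz in le; lra.
Qed.

(** Since the codifferential is p (n - z p' / p), a lower bound for n - Re (z p' / p) is one for
    its modulus. For the reversal of p this is Turan's inequality, refined by the outer
    coefficients. *)
Lemma turan_codiff n p z : (size p <= n.+1)%N ->
  (forall w, root p w -> 1 <= cmod w) -> cmod z = 1 ->
  (n%:R + (cmod p`_0 - cmod p`_n) / (cmod p`_0 + cmod p`_n)) / 2 * cmod p.[z]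
    <= cmod (codiff n p z).
Proof.
move=> sp rp z1; have [pz0|pz0] := eqVneq p.[z] 0.
  by rewrite pz0 cmod0 mulr0 cmod_ge0.
rewrite codiffE // cmodM mulrC ler_wpM2l ?cmod_ge0 //.
apply: le_trans (Re_le_cmod _); rewrite raddfB /= -[n%:R in leRHS](rmorph_nat (real_complex R)) /=.
by have := Re_log_derivative_le sp rp z1 pz0; lra.
Qed.

Lemma sqr_cmodB_real (x : R) z :
  cmod (x%:C - z) ^+ 2 = cmod z ^+ 2 + x * (x - 2 * complex.Re z).
Proof. by case: z => a b; rewrite !sqr_cmod /=; ring. Qed.

(** The point z p' / p lies in the half-plane Re <= n / 2, hence is no farther from 0 than
    from n. *)
Lemma deriv_le_codiff n p z : (size p <= n.+1)%N ->
  (forall w, root p w -> 1 <= cmod w) -> cmod z = 1 ->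
  cmod p^`().[z] <= cmod (codiff n p z).
Proof.
move=> sp rp z1; have [pz0|pz0] := eqVneq p.[z] 0.
  by rewrite codiff_horner0.
rewrite codiffE // cmodM.
set W := z * _ / _.
have -> : cmod p^`().[z] = cmod p.[z] * cmod W.
  by rewrite -cmodM /W mulrC divfK // cmodM z1 mul1r.
rewrite ler_wpM2l ?cmod_ge0 // -ler_sqr ?nnegrE ?cmod_ge0 //.
rewrite -(rmorph_nat (real_complex R)) sqr_cmodB_real lerDl mulr_ge0 //.
have [s [sE rs le]] := Re_log_derivative rp z1 pz0.
have all1 : all (>= 1) [seq cmod w | w <- s].
  by apply/allP => _ /mapP[w ws ->]; apply/rp/rs.
have := sum_inv1D_le_half all1; rewrite size_map big_map => le1.
have : (size s)%:R <= n%:R :> R.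
  rewrite ler_nat -ltnS (leq_trans _ sp) // {1}sE size_scale ?size_prod_XsubC //.
  by rewrite lead_coef_eq0; apply: contraNneq pz0 => ->; rewrite horner0.
by rewrite -/W in le; lra.
Qed.

End LogDerivative.

(** * A quadrature formula and the maximum principle *)

(** Lagrange interpolation, the basis polynomials being B / (X - z) up to their value at z. *)
Lemma lagrange_nodes (F : fieldType) (s : seq F) (f : {poly F}) (x : F) :
  uniq s -> (size f <= size s)%N -> x \notin s ->
  let B := \prod_(z <- s) ('X - z%:P) in
  f.[x] = \sum_(z <- s) f.[z] * (B.[x] / ((x - z) * B^`().[z])).
Proof.
move=> us sf xs B.
pose L z := \prod_(y <- rem z s) ('X - y%:P).
have BE z : z \in s -> B = ('X - z%:P) * L z.
  by move=> zs; rewrite /B (big_rem z).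
have dB z : z \in s -> B^`().[z] = (L z).[z].
  by move=> zs; rewrite (BE z zs) derivM derivXsubC !hornerE subrr; ring.
have L0 z y : y \in s -> y != z -> (L z).[y] = 0.
  by move=> ys yz; apply/eqP; rewrite -/(root _ _) root_prod_XsubC mem_rem_uniq // inE yz.
have Lz z : z \in s -> (L z).[z] != 0.
  by move=> zs; rewrite -/(root _ _) root_prod_XsubC mem_rem_uniq // inE eqxx.
pose g := f - \sum_(z <- s) (f.[z] / (L z).[z]) *: L z.
have /eqP : g = 0.
  apply: (@roots_geq_poly_eq0 _ g s) => //.
    apply/allP => y ys; rewrite /root /g hornerD hornerN horner_sum (bigD1_seq y) //=.
    rewrite hornerZ divfK ?Lz // big_seq_cond big1 ?addr0 ?subrr // => z /andP[zs zy].
    by rewrite hornerZ (L0 z y ys) ?mulr0 1?eq_sym.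
  rewrite (leq_trans (size_polyD _ _)) // size_polyN geq_max sf.
  apply: leq_trans (size_sum _ _ _) _; apply/bigmax_leqP_seq => z zs _.
  apply: leq_trans (size_scale_leq _ _) _.
  by rewrite size_prod_XsubC size_rem // prednK //; case: (s) zs.
rewrite subr_eq0 => /eqP {1}->; rewrite horner_sum big_seq [RHS]big_seq.
apply: eq_bigr => z zs.
have xz : x - z != 0 by rewrite subr_eq0; apply: contraNneq xs => ->.
rewrite hornerZ (dB z zs) (BE z zs) hornerM hornerXsubC.
by field; rewrite xz Lz.
Qed.

Section Interpolation.
Variable R : rcfType.
Implicit Types (z w u : R[i]) (q : {poly R[i]}).

(** Its zeros are the points where the finite Blaschke product
    z^(N+1) (z - w) / (1 - conj(w) z) takes the value u, see [node_polyE]. *)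
Definition node_poly N w u : {poly R[i]} :=
  'X^(N.+2) - w *: 'X^(N.+1) + (u * w^*) *: 'X - u%:P.

Lemma node_polyE N w u z :
  (node_poly N w u).[z] = z ^+ N.+1 * (z - w) - u * (1 - w^* * z).
Proof. by rewrite /node_poly !hornerE exprS; ring. Qed.

Lemma size_node_poly N w u : size (node_poly N w u) = N.+3.
Proof.
rewrite /node_poly -!addrA size_polyDl size_polyXn //.
rewrite ltnS (leq_trans (size_polyD _ _)) // geq_max size_polyN.
rewrite (leq_trans (size_scale_leq _ _)) ?size_polyXn //=.
rewrite (leq_trans (size_polyD _ _)) // geq_max size_polyN.
rewrite (leq_trans (size_scale_leq _ _)) ?size_polyX //=.
by rewrite (leq_trans (size_polyC_leq1 _)).
Qed.

Lemma monic_node_poly N w u : node_poly N w u \is monic.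
Proof.
rewrite monicE lead_coefE size_node_poly /= /node_poly.
by rewrite !coefE eqxx (gtn_eqF (ltnSn N.+1)) /= !mulr0 subr0 addr0 subr0.
Qed.

Lemma sqr_cmod_blaschke z w :
  cmod (1 - w^* * z) ^+ 2 - cmod (z - w) ^+ 2 = (1 - cmod w ^+ 2) * (1 - cmod z ^+ 2).
Proof. by case: z w => a b [c d]; rewrite !sqr_cmod /=; ring. Qed.

(** A finite Blaschke product has modulus < 1 inside the disk and > 1 outside. *)
Lemma node_unit N w u z : cmod u = 1 -> cmod w < 1 ->
  root (node_poly N w u) z -> cmod z = 1.
Proof.
move=> u1 w1; rewrite /root node_polyE subr_eq0 => /eqP /(congr1 cmod).
rewrite !cmodM cmodX u1 mul1r => e.
have := sqr_cmod_blaschke z w.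
have w2 : 0 < 1 - cmod w ^+ 2 by have := cmod_ge0 w; nra.
have := cmod_ge0 (z - w); have := cmod_ge0 (1 - w^* * z); have := cmod_ge0 z.
move: e; set x := cmod z; set a := cmod (z - w); set b := cmod (_ - _).
move=> e x0 b0 a0 h.
have [x1|x1|//] := ltgtP x 1.
  have y1 : x ^+ N.+1 <= 1 by rewrite exprn_ile1 // ltW.
  have ba : b <= a by rewrite -e ler_piMl.
  have : 0 < (1 - cmod w ^+ 2) * (1 - x ^+ 2) by rewrite mulr_gt0 //; nra.
  nra.
have y1 : 1 <= x ^+ N.+1 by rewrite exprn_ege1 // ltW.
have ab : a <= b by rewrite -e ler_peMl.
have : (1 - cmod w ^+ 2) * (1 - x ^+ 2) < 0 by rewrite pmulr_rlt0 //; nra.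
nra.
Qed.

(** The Lagrange weight of the node z for evaluation at w in closed form, which makes its
    positivity visible, see [node_weightE]. *)
Definition node_weight N w z : R :=
  (1 - cmod w ^+ 2) / (N.+1%:R * cmod (1 - w^* * z) ^+ 2 + (1 - cmod w ^+ 2)).

Lemma node_weight_ge0 N w z : cmod w < 1 -> 0 <= node_weight N w z.
Proof.
move=> w1; have w2 : 0 <= 1 - cmod w ^+ 2 by have := cmod_ge0 w; nra.
by rewrite divr_ge0 // addr_ge0 // mulr_ge0 // sqr_ge0.
Qed.

(** At a zero z the derivative of the node polynomial is u D / (z - w), where D is the
    denominator of the weight; in particular the zeros are simple. *)
Lemma node_weightE N w u z : cmod u = 1 -> cmod w < 1 ->
  root (node_poly N w u) z ->
  (node_poly N w u)^`().[z] != 0 /\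
  (node_poly N w u).[w] / ((w - z) * (node_poly N w u)^`().[z])
    = (node_weight N w z)%:C.
Proof.
move=> u1 w1 rz; have z1 := node_unit u1 w1 rz.
have u0 : u != 0 by rewrite -cmod_gt0 u1.
have z0 : z != 0 by rewrite -cmod_gt0 z1.
have w2 : 0 < 1 - cmod w ^+ 2 by have := cmod_ge0 w; nra.
have zw : z - w != 0.
  by rewrite subr_eq0; apply: contraTneq w1 => <-; rewrite z1 ltxx.
pose h := (1 - cmod w ^+ 2)%:C.
pose D := (N.+1%:R * cmod (1 - w^* * z) ^+ 2 + (1 - cmod w ^+ 2))%:C.
have hE : h = 1 - w * w^* by rewrite mulcJ /h rmorphB rmorph1.
have DE : D = N.+1%:R * ((1 - w^* * z) * (1 - w * z^-1)) + (1 - w * w^*).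
  rewrite /D rmorphD rmorphM rmorph_nat /= -/h hE -mulcJ unit_invJ //.
  by rewrite rmorphB rmorph1 rmorphM /= conjCK.
have dB : (node_poly N w u)^`().[z] * (z - w) = u * D.
  have e : z ^+ N * (z - w) = u * (1 - w^* * z) / z.
    move: rz; rewrite /root node_polyE subr_eq0 => /eqP <-.
    by rewrite exprS; field.
  have -> : (node_poly N w u)^`().[z] * (z - w) =
      N.+2%:R * z * (z ^+ N * (z - w)) - w * N.+1%:R * (z ^+ N * (z - w)) + u * w^* * (z - w).
    rewrite /node_poly derivB derivD derivB !derivZ !derivXn derivX derivC.
    rewrite -[N.+2.-1]/N.+1 -[N.+1.-1]/N.
    rewrite -[_ *+ N.+2]scaler_nat -[_ *+ N.+1]scaler_nat.
    rewrite !(hornerD, hornerN, hornerZ, hornerXn, hornerC) [z ^+ N.+1]exprS.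
    by ring.
  by rewrite e DE -[N.+2%:R]natr1; field.
have D0 : D != 0.
  rewrite -cmod_eq0 cmod_real normr_eq0 gt_eqF //.
  by rewrite ltr_wpDl // mulr_ge0 // sqr_ge0.
split.
  by apply: contra_neq D0 => dB0; apply: (mulfI u0); rewrite -dB dB0 mul0r mulr0.
have -> : (node_poly N w u).[w] = - (u * h) by rewrite node_polyE subrr hE; ring.
rewrite mulrC -opprB mulNr invrN mulrNN [(z - w) * _]mulrC dB invfM mulrACA mulVf // mul1r.
rewrite /node_weight rmorphM /= mulrC; congr (_ * _).
by rewrite -/D; exact/esym/(fmorphV (real_complex R)).
Qed.

(** Subtracting q_n times the monic node polynomial from q does not change q at the nodes and
    brings the degree below their number, so that Lagrange interpolation is exact; the value
    of the node polynomial at w is -u (1 - |w|^2). The weights add up to 1 by the case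
    q = 1. *)
Lemma quadrature N w u : cmod u = 1 -> cmod w < 1 ->
  exists s : seq R[i], [/\ forall z, z \in s -> cmod z = 1,
    \sum_(z <- s) node_weight N w z = 1 &
    forall q, (size q <= N.+3)%N ->
      q.[w] + u * (1 - cmod w ^+ 2)%:C * q`_N.+2
        = \sum_(z <- s) q.[z] * (node_weight N w z)%:C].
Proof.
move=> u1 w1; set B := node_poly N w u.
have [s] := closed_field_poly_normal B.
rewrite (monicP (monic_node_poly N w u)) scale1r => BE.
have rs z : z \in s -> root B z by rewrite BE root_prod_XsubC.
have s1 z : z \in s -> cmod z = 1 by move=> /rs; apply: node_unit.
have szs : size s = N.+2.
  by apply: succn_inj; rewrite -(size_node_poly N w u) -/B BE size_prod_XsubC.
have us : uniq s.
  rewrite -separable_prod_XsubC -BE unlock; apply: Pdiv.ClosedField.root_coprimep.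
  by move=> z /(node_weightE u1 w1) [].
have ws : w \notin s by apply: contraTN w1 => /s1 ->; rewrite ltxx.
have quad q : (size q <= N.+3)%N ->
    q.[w] + u * (1 - cmod w ^+ 2)%:C * q`_N.+2
        = \sum_(z <- s) q.[z] * (node_weight N w z)%:C.
  move=> sq; pose f := q - q`_N.+2 *: B.
  have Bw : B.[w] = - (u * (1 - cmod w ^+ 2)%:C).
    by rewrite node_polyE subrr rmorphB rmorph1 /= -mulcJ; ring.
  have -> : q.[w] + u * (1 - cmod w ^+ 2)%:C * q`_N.+2 = f.[w].
    by rewrite /f hornerD hornerN hornerZ Bw; ring.
  have sf : (size f <= size s)%N.
    rewrite szs; apply/leq_sizeP => j; rewrite leq_eqVlt => /predU1P [<-|jN].
      rewrite coefB coefZ.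
      have -> : B`_N.+2 = 1.
        by move/monicP: (monic_node_poly N w u); rewrite lead_coefE size_node_poly.
      by rewrite mulr1 subrr.
    have Bj : B`_j = 0 by rewrite nth_default // size_node_poly.
    by rewrite coefB coefZ Bj mulr0 subr0 nth_default // (leq_trans sq).
  rewrite (lagrange_nodes us sf ws) -BE big_seq [RHS]big_seq; apply: eq_bigr => z zs.
  have [_ ->] := node_weightE u1 w1 (rs z zs).
  by rewrite /f hornerD hornerN hornerZ (eqP (rs z zs)) mulr0 subr0.
exists s; split=> //.
have := quad 1; rewrite size_polyC (leq_trans (leq_b1 _)) // => /(_ isT).
rewrite hornerC coefC mulr0 addr0 => /(congr1 (@complex.Re R)) /= ->.
rewrite raddf_sum; apply: eq_bigr => z _; rewrite hornerC mul1r //.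
Qed.

(** Choose the phase u in [quadrature] so that the two terms on its left-hand side are
    aligned. *)
Lemma sharp_max_principle n q M w : (1 < n)%N -> (size q <= n.+1)%N ->
  (forall z, cmod z = 1 -> cmod q.[z] <= M) -> cmod w <= 1 ->
  cmod q.[w] + (1 - cmod w ^+ 2) * cmod q`_n <= M.
Proof.
case: n => [|[|N]] // _ sq qM; rewrite le_eqVlt => /predU1P [w1|w1].
  by rewrite w1 expr1n subrr mul0r addr0 qM.
have w2 : 0 <= 1 - cmod w ^+ 2 by have := cmod_ge0 w; nra.
have [u u1 uE] := polar q.[w]; have [v v1 vE] := polar q`_N.+2.
have v0 : v != 0 by rewrite -cmod_gt0 v1.
have uv1 : cmod (u / v) = 1 by rewrite cmodM cmodV u1 v1 divr1.
have [s [s1 sum1 quad]] := quadrature N uv1 w1.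
have -> : cmod q.[w] + (1 - cmod w ^+ 2) * cmod q`_N.+2 =
    cmod (q.[w] + u / v * (1 - cmod w ^+ 2)%:C * q`_N.+2).
  move: (cmod_ge0 q.[w]) (cmod_ge0 q`_N.+2) uE vE.
  set a := cmod q.[w]; set b := cmod q`_N.+2 => a0 b0 -> ->.
  rewrite (_ : _ + u / v * _ * _ = (a + (1 - cmod w ^+ 2) * b)%:C * u).
    by rewrite cmodM u1 mulr1 cmod_real ger0_norm // addr_ge0 ?mulr_ge0.
  by rewrite [in RHS]rmorphD /= [in RHS]rmorphM /=; field.
rewrite (quad q sq) (le_trans (cmod_sum _ _)) // -[leRHS]mulr1 -sum1 mulr_sumr.
rewrite big_seq [leRHS]big_seq ler_sum // => z zs.
rewrite cmodM cmod_real ger0_norm ?node_weight_ge0 // ler_wpM2r ?node_weight_ge0 //.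
by rewrite qM // s1.
Qed.

Lemma max_principle q M w :
  (forall z, cmod z = 1 -> cmod q.[z] <= M) -> cmod w <= 1 -> cmod q.[w] <= M.
Proof.
move=> qM w1.
(* any formal degree above that of q makes the coefficient term vanish *)
have := @sharp_max_principle (size q).+2 q M w isT (leqW (leqW (leqnSn _))) qM w1.
by rewrite nth_default ?cmod0 ?mulr0 ?addr0 // -addn2 leq_addr.
Qed.

End Interpolation.

(** * The minimum principle *)

Section MinPrinciple.
Variable R : realType.
Implicit Types (z w : R[i]) (p q : {poly R[i]}).

Lemma exists_expr_ge (x y : R) : 1 < x -> exists N, y <= x ^+ N.
Proof.
move=> x1; have bern N : 1 + N%:R * (x - 1) <= x ^+ N.
  elim: N => [|N IH]; first by rewrite mul0r addr0 expr0.
  rewrite exprS -[N.+1%:R]natr1; apply: le_trans (ler_wpM2l _ IH); last lra.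
  by have := mulr_ge0 (ler0n R N) (sqr_ge0 (x - 1)); lra.
have [y0|y0] := leP y 0; first by exists 0%N; rewrite expr0; lra.
have x0 : 0 < x - 1 by lra.
exists (Num.bound (y / (x - 1))); apply: le_trans (bern _).
have : y / (x - 1) < (Num.bound (y / (x - 1)))%:R.
  by rewrite archi_boundP // divr_ge0 // ltW.
rewrite ltr_pdivrMr //; lra.
Qed.

(** Truncating the geometric series of 1 / (z - w) after N terms leaves the factor
    1 - (z / w)^N, which is uniformly close to 1 on the closed disk. *)
Lemma approx_inverse (s : seq R[i]) (d : R) : all (fun w => 1 < cmod w) s ->
  0 < d -> d < 1 -> exists h : {poly R[i]}, forall z, cmod z <= 1 ->
    1 - d <= cmod (\prod_(w <- s) ('X - w%:P) * h).[z] <= 1 + d.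
Proof.
elim: s d => [|w s IH] d /=.
  by move=> _ d0 d1; exists 1 => z _; rewrite big_nil mul1r hornerC cmod1; lra.
case/andP=> w1 s1 d0 d1; (* (1 - d/3)^2 >= 1 - d and (1 + d/3)^2 <= 1 + d *)
have [||h hP] := IH (d / 3) s1; try lra.
have [N wN] := exists_expr_ge (3 / d) w1.
have wN0 : w ^+ N != 0 by rewrite expf_neq0 // -cmod_gt0; lra.
exists (- (w ^+ N)^-1 *: (\sum_(i < N) 'X^(N.-1 - i) * w%:P ^+ i) * h) => z z1.
have {hP} := hP z z1.
rewrite big_cons !hornerM; set P := (\prod_(_ <- _) _).[z].
set g := (_ *: _).[z].
have gE : ('X - w%:P).[z] * g = 1 - z ^+ N / w ^+ N.
  rewrite /g hornerZ mulrCA -hornerM -subrXX hornerD hornerN -polyC_exp hornerXn hornerC.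
  by field.
rewrite (_ : _ * (g * h.[z]) = ('X - w%:P).[z] * g * (P * h.[z])); last by ring.
rewrite gE [cmod (_ * (P * _))]cmodM; set y := cmod (P * h.[z]).
have zw : cmod (z ^+ N / w ^+ N) <= d / 3.
  rewrite cmodM cmodV !cmodX -[leRHS]mul1r -[d / 3]invf_div.
  rewrite ler_pM ?exprn_ge0 ?invr_ge0 ?exprn_ge0 ?cmod_ge0 //.
    by rewrite exprn_ile1 ?cmod_ge0.
  rewrite lef_pV2 ?posrE ?exprn_gt0 ?divr_gt0 //; lra.
have := cmod_sub 1 (z ^+ N / w ^+ N); have := cmodD 1 (- (z ^+ N / w ^+ N)).
rewrite cmod1 cmodN; set x := cmod (1 - _) => xle xge /andP[yge yle].
by apply/andP; split; nra.
Qed.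

(** If m > 0 there is no zero on the circle, so p has a polynomial approximate inverse on the
    closed disk, to which the maximum principle applies. *)
Lemma min_principle p m w : (forall z, root p z -> 1 <= cmod z) ->
  (forall z, cmod z = 1 -> m <= cmod p.[z]) -> cmod w <= 1 -> m <= cmod p.[w].
Proof.
move=> rp pm w1; have [m0|m0] := leP m 0; first exact: le_trans m0 (cmod_ge0 _).
have {}rp z : root p z -> 1 < cmod z.
  move=> rz; rewrite lt_neqAle rp // andbT eq_sym; apply: contraTneq m0 => /pm.
  by rewrite (eqP rz) cmod0 -leNgt.
have [s sE] := closed_field_poly_normal p; set a := lead_coef p in sE.
have p0 : a != 0.
  rewrite lead_coef_eq0; apply/negP => /eqP pz; have := pm 1.
  by rewrite pz horner0 cmod0 cmod1 leNgt m0 => /(_ erefl).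
have s1 : all (fun z => 1 < cmod z) s.
  by apply/allP => z zs; apply: rp; rewrite sE rootZ // root_prod_XsubC.
rewrite leNgt; apply/negP; set y := cmod p.[w] => ym.
have y0 : 0 <= y by exact: cmod_ge0.
(* y (1 + d) >= m (1 - d) fails for this d *)
pose d := (m - y) / (2 * (m + y)).
have d0 : 0 < d by rewrite divr_gt0; lra.
have d1 : d < 1 by rewrite ltr_pdivrMr; lra.
have dE : d * (m + y) * 2 = m - y by rewrite /d; field; rewrite gt_eqF //; lra.
have [h hP] := approx_inverse s1 d0 d1.
have a0 : 0 < cmod a by rewrite cmod_gt0.
have hz z : cmod z <= 1 -> cmod a * (1 - d) <= cmod p.[z] * cmod h.[z] <= cmod a * (1 + d).
  by move=> /hP; rewrite -cmodM -hornerM sE -scalerAl hornerZ cmodM !ler_pM2l.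
have hw : cmod h.[w] <= cmod a * (1 + d) / m.
  apply: max_principle w1 => z z1; rewrite ler_pdivlMr // mulrC.
  have /andP[_ le] := hz z ltac:(by rewrite z1).
  by apply: le_trans le; rewrite ler_wpM2r ?cmod_ge0 // pm.
have /andP[+ _] := hz w w1; rewrite -/y => hge.
have : cmod a * (1 - d) * m <= y * (cmod a * (1 + d)).
  rewrite -ler_pdivlMr // -mulrA; apply: le_trans hge _.
  by rewrite ler_wpM2l.
rewrite -mulrA [y * _]mulrCA ler_pM2l //; nra.
Qed.

End MinPrinciple.

(** * Derivative and codifferential on the unit circle *)

Section CircleInequalities.
Variable R : realType.
Implicit Types (z w c : R[i]) (p : {poly R[i]}).

Lemma root_ge1_coef0 p : (forall w, root p w -> 1 <= cmod w) -> 0 < cmod p`_0.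
Proof.
move=> rp; rewrite cmod_gt0 -horner_coef0; apply/negP => /rp; rewrite cmod0; lra.
Qed.

Lemma codiffD_const n p c z : codiff n (p + c%:P) z = codiff n p z + n%:R * c.
Proof. by rewrite /codiff derivD derivC addr0 hornerD hornerC; ring. Qed.

Lemma derivD_const p c : (p + c%:P)^`() = p^`().
Proof. by rewrite derivD derivC addr0. Qed.

Lemma sizeD_const n p c : (size p <= n.+1)%N -> (size (p + c%:P)%R <= n.+1)%N.
Proof.
by move=> sp; rewrite (leq_trans (size_polyD _ _)) // geq_max sp (leq_trans (size_polyC_leq1 _)).
Qed.

(** For |c| > M the polynomial p - c has no zero in the disk, so [deriv_le_codiff] applies to
    it; its codifferential is that of p minus n c, and the phase of c is free. *)
Lemma deriv_codiff_le n p M z : (0 < n)%N -> (size p <= n.+1)%N ->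
  (forall w, cmod w = 1 -> cmod p.[w] <= M) -> cmod z = 1 ->
  cmod p^`().[z] + cmod (codiff n p z) <= n%:R * M.
Proof.
move=> n0 sp pM z1; have nR : 0 < n%:R :> R by rewrite ltr0n.
have M0 : 0 <= M by apply: le_trans (pM z z1); exact: cmod_ge0.
have [e e1 eE] := polar (codiff n p z).
have key t : n%:R * M < t -> cmod p^`().[z] <= `|cmod (codiff n p z) - t|.
  move=> tM; pose c := - ((t / n%:R)%:C * e).
  have cE : cmod c = t / n%:R.
    rewrite cmodN cmodM e1 mulr1 cmod_real ger0_norm // divr_ge0 // ltW //.
    by rewrite (le_lt_trans _ tM) // mulr_ge0 // ltW.
  have := @deriv_le_codiff R n (p + c%:P) z (sizeD_const _ sp) _ z1.
  rewrite derivD_const codiffD_const.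
  rewrite (_ : codiff n p z + _ = (cmod (codiff n p z) - t)%:C * e); last first.
    rewrite {1}eE /c rmorphB /= [(t / _)%:C]rmorphM /= (fmorphV (real_complex R)) rmorph_nat.
    by field; rewrite pnatr_eq0 -lt0n.
  rewrite cmodM e1 mulr1 cmod_real; apply => w.
  apply: contraTT; rewrite -ltNge => w1; apply/negP.
  rewrite /root hornerD hornerC addr_eq0 => /eqP pw.
  have := max_principle pM (ltW w1); rewrite pw cmodN cE ler_pdivrMr // mulrC; lra.
have aM : cmod (codiff n p z) <= n%:R * M.
  rewrite leNgt; apply/negP => /[dup] /key; rewrite subrr normr0 => d0.
  have {d0} /eqP : cmod p^`().[z] == 0 by rewrite eq_le d0 cmod_ge0.
  move/ComplexField.Normc.eq0_normc; rewrite /codiff => ->.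
  by rewrite mulr0 subr0 cmodM cmod_nat ltr_pM2l // ltNge pM.
rewrite leNgt; apply/negP => lt.
have := key ((n%:R * M + (cmod p^`().[z] + cmod (codiff n p z))) / 2).
by rewrite ler0_norm; lra.
Qed.

Section LowerBound.
Variables (n : nat) (p : {poly R[i]}) (m : R) (z : R[i]).
Hypotheses (n0 : (0 < n)%N) (sp : (size p <= n.+1)%N).
Hypothesis rp : forall w, root p w -> 1 <= cmod w.
Hypotheses (m0 : 0 <= m) (pm : forall w, cmod w = 1 -> m <= cmod p.[w]).
Hypothesis z1 : cmod z = 1.

(** A Rouche argument for a constant perturbation: a zero w of p + c inside the disk would
    have |p(w)| = |c| < m, against the minimum principle. *)
Lemma root_ge1D_const c : cmod c < m -> forall w, root (p + c%:P) w -> 1 <= cmod w.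
Proof.
move=> cm w; apply: contraTT; rewrite -ltNge => w1; apply/negP.
rewrite /root hornerD hornerC addr_eq0 => /eqP pw.
by have := min_principle rp pm (ltW w1); rewrite pw cmodN; lra.
Qed.

(* [deriv_le_codiff] for p + c with |c| = t / n and c opposite in phase to the codifferential *)
Let perturbed_deriv_le t : 0 <= t -> t < n%:R * m ->
  cmod p^`().[z] <= `|cmod (codiff n p z) - t|.
Proof.
have nR : 0 < n%:R :> R by rewrite ltr0n.
have [e e1 eE] := polar (codiff n p z).
move=> t0 tm; pose c := - ((t / n%:R)%:C * e).
have cE : cmod c = t / n%:R.
  by rewrite cmodN cmodM e1 mulr1 cmod_real ger0_norm // divr_ge0 // ltW.
have cm : cmod c < m by rewrite cE ltr_pdivrMr // mulrC.
have := deriv_le_codiff (sizeD_const c sp) (root_ge1D_const cm) z1.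
rewrite derivD_const codiffD_const.
rewrite (_ : codiff n p z + _ = (cmod (codiff n p z) - t)%:C * e).
  by rewrite cmodM e1 mulr1 cmod_real.
rewrite {1}eE /c rmorphB /= [(t / _)%:C]rmorphM /= (fmorphV (real_complex R)) rmorph_nat.
by field; rewrite pnatr_eq0 -lt0n.
Qed.

(** Otherwise [perturbed_deriv_le] at the modulus of the codifferential forces
    p'(z) = 0, and then the codifferential is n p(z). *)
Lemma codiff_ge : n%:R * m <= cmod (codiff n p z).
Proof.
rewrite leNgt; apply/negP => /[dup] /perturbed_deriv_le; rewrite subrr normr0 => /(_ (cmod_ge0 _)) d0.
have {d0} /eqP : cmod p^`().[z] == 0 by rewrite eq_le d0 cmod_ge0.
move/ComplexField.Normc.eq0_normc; rewrite /codiff => ->.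
by rewrite mulr0 subr0 cmodM cmod_nat ltr_pM2l ?ltr0n // ltNge pm.
Qed.

(** The limit t -> n m of [perturbed_deriv_le]. *)
Lemma deriv_le_codiff_min : cmod p^`().[z] <= cmod (codiff n p z) - n%:R * m.
Proof.
have ge := codiff_ge; set a := cmod _ in ge *; set d := cmod _.
have [nm0|nm0] := leP (n%:R * m) 0.
  have := deriv_le_codiff sp rp z1; rewrite -/d -/a => le.
  by apply: le_trans le _; lra.
rewrite leNgt; apply/negP => lt.
(* the midpoint of n m and max(0, a - d) contradicts [perturbed_deriv_le] *)
have [ad|ad] := leP 0 (a - d).
  have := @perturbed_deriv_le ((n%:R * m + (a - d)) / 2).
  by rewrite -/d -/a ger0_norm; lra.
have := @perturbed_deriv_le (n%:R * m / 2); rewrite -/d -/a ger0_norm; lra.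
Qed.

(** Apply [turan_codiff] to p + c with c of modulus t and of phase opposite to the
    codifferential, whose modulus then drops by exactly n t; the fraction is increasing in
    |p_0|, and |p_0 + c| >= |p_0| - t. *)
Lemma turan_codiff_min l : 0 <= l -> l < 1 ->
  let t := l * m in
  let s := (cmod p`_0 - t - cmod p`_n) / (cmod p`_0 - t + cmod p`_n) in
  0 <= n%:R + s /\
  n%:R * t + (n%:R + s) / 2 * (cmod p.[z] - t) <= cmod (codiff n p z).
Proof.
move=> l0 l1 t s.
have t0 : 0 <= t by rewrite mulr_ge0.
have tm : t <= m by rewrite -[leRHS]mul1r ler_wpM2r // ltW.
have [e e1 eE] := polar (codiff n p z).
pose c := - (t%:C * e).
have cE : cmod c = t by rewrite cmodN cmodM e1 mulr1 cmod_real ger0_norm.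
have rc w : root (p + c%:P) w -> 1 <= cmod w.
  move: m0; rewrite le_eqVlt => /predU1P[m00|mp].
    have -> : c = 0 by apply/eqP; rewrite -cmod_eq0 cE /t -m00 mulr0.
    by rewrite polyC0 addr0; apply: rp.
  by apply: root_ge1D_const; rewrite cE /t gtr_pMl.
have p0t : 0 < cmod p`_0 - t.
  move: m0; rewrite le_eqVlt => /predU1P[m00|mp].
    by rewrite /t -m00 mulr0 subr0 root_ge1_coef0.
  rewrite subr_gt0; have lt : t < m by rewrite /t gtr_pMl.
  apply: lt_le_trans lt _.
  rewrite -horner_coef0; apply: min_principle => //; rewrite cmod0; lra.
have n1 : 1 <= n%:R :> R by rewrite (ler_nat _ 1).
have pn0 := cmod_ge0 p`_n.
have s1 : -1 <= s by rewrite /s ler_pdivlMr; lra.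
have ns0 : 0 <= n%:R + s by lra.
split=> //.
have vt : n%:R * t <= cmod (codiff n p z).
  by apply: le_trans codiff_ge; rewrite ler_wpM2l // ltW // ltr0n.
have := turan_codiff (sizeD_const c sp) rc z1.
rewrite codiffD_const (_ : codiff n p z + _ = (cmod (codiff n p z) - n%:R * t)%:C * e); last first.
  by rewrite {1}eE /c rmorphB /= [(n%:R * t)%:C]rmorphM /= rmorph_nat; ring.
rewrite [leRHS]cmodM e1 mulr1 cmod_real (ger0_norm (_ : 0 <= _)) ?subr_ge0 //.
rewrite !coefD !coefC /= gtn_eqF // addr0 lerBrDl; apply: le_trans.
rewrite lerD2l ler_pM //; first by rewrite divr_ge0.
- by rewrite subr_ge0 (le_trans tm) // pm.
- rewrite ler_pM2r ?invr_gt0 // lerD2l /s.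
  have le : cmod p`_0 - t <= cmod (p`_0 + c).
    by rewrite -cE cmod_subD.
  set x := cmod (_ + c) in le *; set y := cmod p`_n in pn0 *.
  rewrite ler_pdivrMr; last by lra.
  rewrite mulrAC ler_pdivlMr; last by lra.
  nra.
by rewrite hornerD hornerC -cE cmod_subD.
Qed.

End LowerBound.

(** Add the upper bound of [deriv_codiff_le] and the lower bound of [deriv_le_codiff_min] on
    the codifferential. *)
Lemma erdos_lax_min n p m M z : (0 < n)%N -> (size p <= n.+1)%N ->
  (forall w, root p w -> 1 <= cmod w) ->
  (forall w, cmod w = 1 -> m <= cmod p.[w]) ->
  (forall w, cmod w = 1 -> cmod p.[w] <= M) -> cmod z = 1 ->
  cmod p^`().[z] <= n%:R * (M - m) / 2.
Proof.
move=> n0 sp rp pm pM z1.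
have := deriv_codiff_le n0 sp pM z1.
have := deriv_le_codiff_min n0 sp rp pm z1; lra.
Qed.

End CircleInequalities.

(** * Reversal *)

Section Reversal.
Variable R : rcfType.
Implicit Types (z w : R[i]) (p q : {poly R[i]}).

Definition recip n p : {poly R[i]} := \poly_(i < n.+1) (p`_(n - i))^*.

Lemma size_recip n p : (size (recip n p) <= n.+1)%N.
Proof. exact: size_poly. Qed.

Lemma coef_recip n p i : (i <= n)%N -> (recip n p)`_i = (p`_(n - i))^*.
Proof. by move=> le; rewrite coef_poly ltnS le. Qed.

Lemma horner_recip n p z : (size p <= n.+1)%N -> z != 0 ->
  (recip n p).[z] = z ^+ n * (p.[(z^*)^-1])^*.
Proof.
move=> sp z0; rewrite horner_poly (reindex_inj rev_ord_inj) /=.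
rewrite (horner_coef_wide _ sp) rmorph_sum mulr_sumr; apply: eq_bigr => i _.
have lein : (i <= n)%N by rewrite -ltnS.
rewrite subSS subKn // rmorphM rmorphXn fmorphV /= conjCK mulrCA; congr (_ * _).
by rewrite exprB ?unitfE // exprVn.
Qed.

Lemma horner_recip1 n p z : (size p <= n.+1)%N -> cmod z = 1 ->
  (recip n p).[z] = z ^+ n * (p.[z])^*.
Proof.
move=> sp z1; have z0 : z != 0 by rewrite -cmod_gt0 z1.
by rewrite horner_recip // -(unit_invJ z1) invrK.
Qed.

Lemma cmod_recip1 n p z : (size p <= n.+1)%N -> cmod z = 1 ->
  cmod (recip n p).[z] = cmod p.[z].
Proof. by move=> sp z1; rewrite horner_recip1 // cmodM cmodX z1 expr1n mul1r cmodJ. Qed.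

Lemma root_recip n p : size p = n.+1 -> (forall w, root p w -> cmod w <= 1) ->
  forall w, root (recip n p) w -> 1 <= cmod w.
Proof.
move=> sp rp w rw; have [w0|w0] := eqVneq w 0.
  move: rw; rewrite w0 /root horner_coef0 coef_recip // subn0 conjC_eq0.
  by rewrite -[n]/(n.+1.-1) -sp -lead_coefE lead_coef_eq0 -size_poly_eq0 sp.
move: rw; rewrite /root horner_recip ?sp // mulf_eq0 expf_eq0 (negPf w0) andbF /=.
rewrite conjC_eq0 => /rp; rewrite cmodV cmodJ invf_le1 // cmod_gt0 //.
Qed.

(** The codifferential of the reversal of p is the reversal of X p'. *)
Lemma codiff_recip n p z : (size p <= n.+1)%N -> cmod z = 1 ->
  cmod (codiff n (recip n p) z) = cmod p^`().[z].
Proof.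
move=> sp z1.
have sXp : (size ('X * p^`())%R <= n.+1)%N.
  have [->|p0] := eqVneq p^`() 0; first by rewrite mulr0 size_poly0.
  rewrite mulrC size_mulX // (leq_trans (lt_size_deriv _)) //.
  by apply: contraNneq p0 => ->; rewrite derivC.
have -> : codiff n (recip n p) z = (recip n ('X * p^`())).[z].
  rewrite /codiff -{1}hornerZ -[z in z * _]hornerX -hornerM -hornerN -hornerD.
  congr (_.[_]); apply/polyP => i; rewrite coefB coefZ coefXM coef_deriv.
  have [lein|ltni] := leqP i n; last first.
    rewrite [RHS]nth_default ?(leq_trans (size_recip _ _)) //.
    rewrite [(recip n p)`_i]nth_default ?(leq_trans (size_recip _ _)) // mulr0 sub0r.
    case: i ltni => [|i] ltni /=; first by rewrite oppr0.
    by rewrite nth_default ?mul0rn ?oppr0 // (leq_trans (size_recip _ _)).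
  rewrite [RHS]coef_recip // coefXM coef_deriv coef_recip //.
  case: i lein => [|i] lein /=.
    rewrite subn0 subr0; have [->|n0] := posnP n; first by rewrite mul0r rmorph0.
    by rewrite prednK // rmorphMn mulr_natl.
  rewrite coef_recip //.
  have [e|ne] := eqVneq (n - i.+1)%N 0%N.
    have -> : n = i.+1 by apply/eqP; rewrite eqn_leq lein -subn_eq0 e eqxx.
    by rewrite subnn /= rmorph0 mulr_natl subrr.
  by rewrite prednK ?lt0n // rmorphMn mulrnBr // mulr_natl.
by rewrite cmod_recip1 // hornerM hornerX cmodM z1 mul1r.
Qed.

End Reversal.

(** * Growth outside the unit disk *)

Section Growth.
Variable R : rcfType.
Implicit Types (z w : R[i]) (p q : {poly R[i]}).

(** [sharp_max_principle] for the reversal of p at the point z / r. *)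
Lemma growth n p M r z : (1 < n)%N -> (size p <= n.+1)%N ->
  (forall w, cmod w = 1 -> cmod p.[w] <= M) -> 1 <= r -> cmod z = 1 ->
  cmod p.[r%:C * z] <= r ^+ n * M - (r ^+ n - r ^+ (n - 2)) * cmod p`_0.
Proof.
move=> n1 sp pM r1 z1; have r0 : 0 < r by lra.
have qM w : cmod w = 1 -> cmod (recip n p).[w] <= M.
  by move=> w1; rewrite cmod_recip1 // pM.
pose w := (r^-1)%:C * z.
have rV : 0 < r^-1 by rewrite invr_gt0.
have wE : cmod w = r^-1 by rewrite cmodM z1 mulr1 cmod_real gtr0_norm.
have w0 : w != 0 by rewrite -cmod_gt0 wE.
have w1 : cmod w <= 1 by rewrite wE invf_le1.
have := sharp_max_principle n1 (size_recip n p) qM w1.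
rewrite coef_recip // subnn cmodJ horner_recip // cmodM cmodX cmodJ wE.
have -> : (w^*)^-1 = r%:C * z.
  have zz : z^* != 0 by rewrite conjC_eq0 -cmod_gt0 z1.
  rewrite /w rmorphM /= -(unit_invJ z1) invfM invrK; congr (_ * _).
  rewrite (_ : ((r^-1)%:C)^* = (r^-1)%:C); last exact: conjc_real.
  by rewrite -(fmorphV (real_complex R)) invrK.
rewrite exprVn -(ler_pM2l (exprn_gt0 n r0)) mulrDr mulVKf ?gt_eqF ?exprn_gt0 //.
have -> : r ^+ (n - 2) = r ^+ n * r^-1 ^+ 2 by rewrite expfB_cond ?gt_eqF // exprVn.
lra.
Qed.

(** In degree 1 the maximum modulus on the circle is exactly |p_0| + |p_1|. *)
Lemma growth_affine p M r z : (size p <= 2)%N ->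
  (forall w, cmod w = 1 -> cmod p.[w] <= M) -> 1 <= r -> cmod z = 1 ->
  cmod p.[r%:C * z] <= r * M - (r - 1) * cmod p`_0.
Proof.
move=> sp pM r1 z1.
have pE w : p.[w] = p`_0 + p`_1 * w.
  by rewrite (horner_coef_wide _ sp) big_ord_recl big_ord1 expr0 mulr1 expr1.
have [u u1 uE] := polar p`_0; have [v v1 vE] := polar p`_1.
have v0 : v != 0 by rewrite -cmod_gt0 v1.
have le1 : cmod p`_0 + cmod p`_1 <= M.
  have := pM (u / v); rewrite cmodM cmodV u1 v1 divr1 => /(_ erefl).
  rewrite pE; move: (cmod_ge0 p`_0) (cmod_ge0 p`_1) uE vE.
  set a := cmod p`_0; set b := cmod p`_1 => a0 b0 -> ->.
  rewrite (_ : _ + b%:C * _ * _ = (a + b)%:C * u).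
    by rewrite cmodM u1 mulr1 cmod_real ger0_norm // addr_ge0.
  by rewrite rmorphD /=; field.
rewrite pE; apply: le_trans (cmodD _ _) _.
rewrite !cmodM z1 mulr1 cmod_real ger0_norm; last lra.
nra.
Qed.

End Growth.

(** * Integration along a ray *)

Section Integration.
Variable R : realType.
Implicit Types (z w : R[i]) (p q : {poly R[i]}).

Lemma nondecreasing_poly (g : {poly R}) a b : a <= b ->
  (forall t, a <= t -> 0 <= g^`().[t]) -> g.[a] <= g.[b].
Proof.
rewrite le_eqVlt => /predU1P[->//|ab] g0.
have [c /itvP cab e] := poly_mvt g ab.
by rewrite -subr_ge0 e mulr_ge0 ?g0 ?cab // subr_ge0 ltW.
Qed.

(** The real part of q along the real axis, as a polynomial, so that the mean value theorem for
    real polynomials applies. *)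
Definition Re_poly q : {poly R} := map_poly (@complex.Re R) q.

Lemma horner_Re_poly q t : (Re_poly q).[t] = complex.Re q.[t%:C].
Proof.
rewrite /Re_poly (horner_coef_wide _ (size_poly _ _)) horner_coef raddf_sum.
apply: eq_bigr => i _ /=; rewrite coef_map_id0 // -rmorphXn /=.
by case: q`_i => a b /=; rewrite mulr0 subr0.
Qed.

Lemma deriv_Re_poly q : (Re_poly q)^`() = Re_poly q^`().
Proof.
by apply/polyP => i; rewrite coef_deriv !coef_map_id0 // coef_deriv raddfMn.
Qed.

Lemma coef_comp_scaleX p (c : R[i]) i : (p \Po (c *: 'X))`_i = c ^+ i * p`_i.
Proof.
elim/poly_ind: p i => [|p a IH] i; first by rewrite comp_poly0 !coef0 mulr0.
rewrite comp_polyD comp_polyM comp_polyX comp_polyC -scalerAr !coefD coefZ !coefMX !coefC.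
case: i => [|i] /=; first by rewrite mulr0 expr0 mul1r.
by rewrite !addr0 IH exprS mulrA.
Qed.

(** This is the derivative of [phi n], see [deriv_phi_poly]; it is the weight of |p_1| in
    [growth] and [growth_affine] applied to p'. *)
Definition kappa n (r : R) : R :=
  if (2 < n)%N then r ^+ (n - 1) - r ^+ (n - 3) else r - 1.

Definition phi_poly n : {poly R} :=
  if (2 < n)%N then n%:R^-1 *: 'X^n - (n - 2)%:R^-1 *: 'X^(n - 2)
  else 2^-1 *: ('X - 1%:P) ^+ 2.

Lemma phi_polyE n k : (1 < n)%N ->
  (phi_poly n).[k] - (phi_poly n).[1] = phi n k.
Proof.
move=> n1; rewrite /phi_poly /phi; case: ifP => n2.
  rewrite !hornerD !hornerN !hornerZ !hornerXn !expr1n !mulr1 !mulrBl !mul1r.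
  by rewrite [_ / n%:R]mulrC [_ / (n - 2)%:R]mulrC; ring.
by rewrite !hornerZ !horner_exp !hornerXsubC subrr expr0n mulr0 subr0 mulrC.
Qed.

Lemma deriv_phi_poly n r : (1 < n)%N -> (phi_poly n)^`().[r] = kappa n r.
Proof.
move=> n1; rewrite /phi_poly /kappa; case: ifP => n2.
  rewrite derivB !derivZ !derivXn hornerD hornerN !hornerZ !hornerMn !hornerXn.
  rewrite -[_ ^+ _ *+ n]mulr_natl -[_ ^+ _ *+ (n - 2)]mulr_natl !mulKf.
  - by rewrite -!subn1 -subnDA.
  - by rewrite pnatr_eq0 -lt0n subn_gt0.
  - by rewrite pnatr_eq0 -lt0n ltnW.
by rewrite derivZ expr2 derivM derivXsubC mul1r mulr1 hornerZ hornerD hornerXsubC; field.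
Qed.

Lemma psi_kappa n k : (1 < n)%N -> 1 <= k -> k * kappa n k = k ^+ n * psi n k.
Proof.
move=> n1 k1; have k0 : k != 0 by rewrite gt_eqF //; lra.
rewrite /kappa /psi; case: ifP => n2.
  case: n n1 n2 => [|[|[|n]]] // _ _.
  rewrite -[(n.+3 - 1)%N]/n.+2 -[(n.+3 - 3)%N]/(n - 0)%N subn0 !exprS; field.
  by rewrite k0.
have -> : n = 2%N by apply/eqP; rewrite eqn_leq n1 leqNgt n2.
by field.
Qed.

Lemma deriv_growth n p A r z : (1 < n)%N -> (size p <= n.+1)%N ->
  (forall w, cmod w = 1 -> cmod p^`().[w] <= A) -> 1 <= r -> cmod z = 1 ->
  cmod p^`().[r%:C * z] <= r ^+ (n - 1) * A - kappa n r * cmod p`_1.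
Proof.
move=> n1 sp pA r1 z1.
have sd : (size p^`() <= n)%N.
  by apply: leq_trans (size_poly _ _) _; case: (size p) sp.
have e : cmod p`_1 = cmod p^`()`_0 by rewrite coef_deriv mulr1n.
rewrite /kappa; case: ifP => n2; rewrite e.
  case: n n1 n2 sp sd => [|[|[|n]]] // _ _ _ sd.
  by have := growth _ sd pA r1 z1; apply.
have n2E : n = 2%N by apply/eqP; rewrite eqn_leq n1 leqNgt n2.
by rewrite n2E expr1; apply: growth_affine => //; rewrite -n2E.
Qed.

(** The integral of [deriv_growth] along the ray through z, in the form of a monotone real
    polynomial g; multiplying p by the phase u^-1 turns the increment of |p| into one of a
    real part. *)
Lemma growth_phi n p A k z : (1 < n)%N -> (size p <= n.+1)%N ->
  (forall w, cmod w = 1 -> cmod p^`().[w] <= A) -> 1 <= k -> cmod z = 1 ->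
  cmod p.[k%:C * z] <= cmod p.[z] + (k ^+ n - 1) * A / n%:R - phi n k * cmod p`_1.
Proof.
move=> n1 sp pA k1 z1.
have nR : n%:R != 0 :> R by rewrite pnatr_eq0 -lt0n ltnW.
have [u u1 uE] := polar (p.[k%:C * z] - p.[z]).
have u0 : u != 0 by rewrite -cmod_gt0 u1.
pose q := u^-1 *: (p \Po (z *: 'X)).
have qE t : q.[t%:C] = u^-1 * p.[t%:C * z].
  by rewrite hornerZ horner_comp hornerZ hornerX [z * _]mulrC.
have dqE t : q^`().[t%:C] = u^-1 * (z * p^`().[t%:C * z]).
  rewrite derivZ deriv_comp hornerZ hornerM horner_comp derivZ derivX !hornerZ hornerX hornerC.
  by rewrite mulr1 [z * t%:C]mulrC [_ * z]mulrC.
pose g : {poly R} := (A / n%:R) *: 'X^n - cmod p`_1 *: phi_poly n - Re_poly q.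
have : g.[1] <= g.[k].
  apply: nondecreasing_poly => // t t1.
  rewrite !derivB !derivZ derivXn deriv_Re_poly !hornerD !hornerN !hornerZ.
  rewrite deriv_phi_poly // horner_Re_poly dqE hornerMn hornerXn.
  rewrite subr_ge0; apply: le_trans (Re_le_cmod _) _.
  rewrite !cmodM cmodV u1 z1 invr1 !mul1r.
  apply: le_trans (deriv_growth n1 sp pA t1 z1) _.
  rewrite -[_ ^+ _ *+ n]mulr_natl mulrA divfK // subn1 [kappa _ _ * _]mulrC [_ * A]mulrC //.
rewrite /g !hornerD !hornerN !hornerZ !hornerXn !horner_Re_poly !qE expr1n.
have : complex.Re (u^-1 * p.[k%:C * z]) - complex.Re (u^-1 * p.[1%:C * z])
    = cmod (p.[k%:C * z] - p.[z]).
  by rewrite -raddfB -mulrBr rmorph1 mul1r {1}uE mulrCA mulVf // mulr1.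
have := cmod_sub p.[k%:C * z] p.[z].
rewrite -(phi_polyE k n1).
set x := complex.Re _; set y := complex.Re _; set a := phi_poly _; set b := a.[1].
rewrite mulrAC -mulrA; lra.
Qed.

End Integration.

(** * The bound and its sharpness *)

Section Bound.
Variable R : realType.

(** With N = n and K = k^n: (1 + K) times the second hypothesis plus (N + s) times the first is
    K (1 + K) times the conclusion. *)
Lemma bound_combination (N K M M' mu t s b c psi phi : R) : 1 <= K -> 0 <= N + s ->
  K * M <= mu + (K - 1) * (mu - t) / 2 - phi * c ->
  N * t + (N + s) / 2 * (mu - t) <= K * (M' - psi * b) ->
  N / (1 + K) * (M + t) + psi * b
    + 1 / (K * (1 + K)) * (s * (K * M - t) + c * phi * (N + s)) <= M'.
Proof.
move=> K1 ns0 h1 h2; have K0 : 0 < K * (1 + K) by rewrite mulr_gt0; lra.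
rewrite -(ler_pM2l K0).
rewrite [leLHS](_ : _ = N * K * (M + t) + K * (1 + K) * (psi * b)
    + (s * (K * M - t) + c * phi * (N + s))); last first.
  by field; rewrite !gt_eqF //; lra.
have g1 := ler_wpM2l ns0 h1.
have g2 := ler_wpM2l (ltac:(lra) : 0 <= 1 + K) h2.
lra.
Qed.

Implicit Types (z w : R[i]) (P : {poly R[i]}).

Lemma deriv_bound_le n k P l : (1 < n)%N -> 1 <= k ->
  size P = n.+1 -> zeros_in_disk k P -> 0 <= l -> l < 1 ->
  deriv_bound n k l P <= maxmod 1 P^`().
Proof.
move=> n1 k1 sP zP l0 l1.
have k0 : 0 < k by lra.
have kC0 : k%:C != 0 :> R[i] by rewrite -cmod_gt0 cmod_real gtr0_norm.
have n0 : (0 < n)%N := ltnW n1.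
have cmodk z : cmod z = 1 -> cmod (k%:C * z) = k.
  by move=> z1; rewrite cmodM z1 mulr1 cmod_real gtr0_norm.
have [[x0 x1 xE] maxM] := maxmodP P (ler01 : 0 <= 1 :> R).
have [[y0 y1 yE] maxmu] := maxmodP P (ltW k0).
have [_ minm] := minmodP P (ltW k0).
have [_ maxM'] := maxmodP P^`() (ler01 : 0 <= 1 :> R).
pose G := P \Po (k%:C *: 'X); pose q := recip n G.
have GE z : G.[z] = P.[k%:C * z] by rewrite horner_comp hornerZ hornerX.
have dGE z : G^`().[z] = k%:C * P^`().[k%:C * z].
  by rewrite deriv_comp hornerM horner_comp derivZ derivX !hornerZ hornerX hornerC mulr1 mulrC.
have coefG i : G`_i = k%:C ^+ i * P`_i by exact: coef_comp_scaleX.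
have cG i : cmod G`_i = k ^+ i * cmod P`_i.
  by rewrite coefG cmodM cmodX cmod_real gtr0_norm.
have an0 : P`_n != 0.
  by rewrite -[n]/(n.+1.-1) -sP -lead_coefE lead_coef_eq0 -size_poly_eq0 sP.
have sG : size G = n.+1.
  apply/eqP; rewrite eqn_leq; apply/andP; split.
    by apply/leq_sizeP => j nj; rewrite coefG nth_default ?mulr0 // sP.
  rewrite ltnNge; apply/negP => /leq_sizeP /(_ n (leqnn n)) /eqP.
  by rewrite coefG mulf_eq0 expf_eq0 (negPf kC0) andbF (negPf an0).
have sG' : (size G <= n.+1)%N by rewrite sG.
have rq w : root q w -> 1 <= cmod w.
  apply: root_recip => // v; rewrite /root GE => /zP.
  by rewrite cmodM cmod_real gtr0_norm // ger_pMr.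
have sq : (size q <= n.+1)%N := size_recip n G.
have q1 z : cmod z = 1 -> cmod q.[z] = cmod P.[k%:C * z].
  by move=> z1; rewrite cmod_recip1 // GE.
set M := maxmod 1 P in xE maxM *; set mu := maxmod k P in yE maxmu.
set m := minmod k P in minm *; set M' := maxmod 1 P^`() in maxM' *.
have qmu z : cmod z = 1 -> cmod q.[z] <= mu by move=> z1; rewrite q1 // maxmu // cmodk.
have qm z : cmod z = 1 -> m <= cmod q.[z] by move=> z1; rewrite q1 // minm // cmodk.
have m0 : 0 <= m by have [[v _ e] _] := minmodP P (ltW k0); rewrite /m -e cmod_ge0.
have mmu : m <= mu by rewrite -yE minm.
have cq i : (i <= n)%N -> cmod q`_i = k ^+ (n - i) * cmod P`_(n - i).
  by move=> le; rewrite coef_recip // cmodJ cG.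
(* |q(kz)| = k^n |P(z)| on the unit circle, so the growth of q bounds M from above *)
have Mmu : k ^+ n * M <= mu + (k ^+ n - 1) * (mu - m) / 2
    - phi n k * (k ^+ (n - 1) * cmod P`_(n - 1)).
  have dq w : cmod w = 1 -> cmod q^`().[w] <= n%:R * (mu - m) / 2.
    exact: erdos_lax_min.
  have := growth_phi n1 sq dq k1 x1; rewrite cq //.
  have kx0 : k%:C * x0 != 0 by rewrite mulf_neq0 // -cmod_gt0 x1.
  rewrite horner_recip // cmodM cmodX (cmodk _ x1) cmodJ GE.
  have -> : k%:C * ((k%:C * x0)^*)^-1 = x0.
    rewrite rmorphM /= (_ : (k%:C)^* = k%:C); last exact: conjc_real.
    by rewrite /= -(unit_invJ x1) invfM invrK mulVKf.
  rewrite xE => le; apply: (le_trans le).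
  have := qmu _ x1.
  rewrite (_ : _ * (_ / 2) / n%:R = (k ^+ n - 1) * (mu - m) / 2); first by lra.
  by field; rewrite pnatr_eq0 -lt0n.
pose z1 := k%:C^-1 * y0.
have z11 : cmod z1 = 1.
  by rewrite cmodM cmodV cmod_real gtr0_norm // y1 mulVf // gt_eqF.
have [] := turan_codiff_min n0 sq rq m0 qm z11 l0 l1.
rewrite q1 // codiff_recip // dGE !cq // subnn subn0 expr0 mul1r mulVKf // yE.
rewrite cmodM cmod_real gtr0_norm // => ns0 turan.
have := deriv_growth n1 (eq_leq sP) maxM' k1 z11.
rewrite mulVKf // -(ler_pM2l k0) mulrBr !mulrA -exprS subn1 prednK // psi_kappa // => growth'.
apply: (@bound_combination _ _ _ _ mu) => //; first by rewrite exprn_ege1.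
  apply: le_trans Mmu _; rewrite lerD2r lerD2l ler_pM2r ?invr_gt0 //.
  rewrite ler_wpM2l ?subr_ge0 ?exprn_ege1 // lerD2l lerN2.
  by rewrite -[leRHS]mul1r ler_wpM2r // ltW.
by apply: le_trans turan _; rewrite mulrBr mulrA.
Qed.

Lemma maxmod_eq (p : {poly R[i]}) (x : R[i]) r M : cmod x = r -> cmod p.[x] = M ->
  (forall z, cmod z = r -> cmod p.[z] <= M) -> maxmod r p = M.
Proof.
move=> xr xM le; have r0 : 0 <= r by rewrite -xr cmod_ge0.
have [[y yr e] ge] := maxmodP p r0.
by apply/eqP; rewrite eq_le -{1}e le // -xM ge.
Qed.

Lemma deriv_bound_eq n k l : (1 < n)%N -> 1 <= k ->
  let Q : {poly R[i]} := 'X^n + ((k ^+ n)%:C)%:P in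
  [/\ size Q = n.+1, zeros_in_disk k Q & maxmod 1 Q^`() = deriv_bound n k l Q].
Proof.
move=> n1 k1 Q.
have k0 : 0 < k by lra.
have n0 : (0 < n)%N := ltnW n1.
have K0 : 0 < k ^+ n by rewrite exprn_gt0.
have sQ : size Q = n.+1.
  by rewrite size_polyDl size_polyXn // ltnS (leq_trans (size_polyC_leq1 _)).
have QE z : Q.[z] = z ^+ n + (k ^+ n)%:C by rewrite hornerD hornerXn hornerC.
have coefQ i : Q`_i = (i == n)%:R + (if i == 0%N then (k ^+ n)%:C else 0).
  by rewrite coefD coefXn coefC.
split=> //.
  move=> z; rewrite /root QE addr_eq0 => /eqP /(congr1 cmod).
  rewrite cmodX cmodN cmod_real gtr0_norm // => e.
  by rewrite -(@ler_pXn2r _ n) ?nnegrE ?cmod_ge0 ?e // ltW.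
have M1 : maxmod 1 Q = 1 + k ^+ n.
  apply: (@maxmod_eq _ 1); first exact: cmod1.
    rewrite QE expr1n (_ : 1 + _ = (1 + k ^+ n)%:C); last by rewrite rmorphD.
    rewrite cmod_real gtr0_norm //.
    by rewrite addr_gt0.
  move=> z z1; rewrite QE (le_trans (cmodD _ _)) // cmodX z1 expr1n.
  by rewrite cmod_real gtr0_norm.
have M'1 : maxmod 1 Q^`() = n%:R.
  have dQ z : Q^`().[z] = n%:R * z ^+ n.-1.
    by rewrite derivD derivC addr0 derivXn hornerMn hornerXn mulr_natl.
  apply: (@maxmod_eq _ 1); first exact: cmod1.
    by rewrite dQ expr1n mulr1 cmod_nat.
  by move=> z z1; rewrite dQ cmodM cmod_nat cmodX z1 expr1n mulr1.
have m0 : minmod k Q = 0.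
  have [_ minm] := minmodP Q (ltW k0).
  have [[v _ e] _] := minmodP Q (ltW k0).
  apply/eqP; rewrite eq_le -{2}e cmod_ge0 andbT.
  (* Q vanishes at every n-th root of - k^n, and these lie on |z| = k *)
  pose z := n.-root (- (k ^+ n)%:C).
  have zn : z ^+ n = - (k ^+ n)%:C by rewrite rootCK.
  have := minm z; rewrite QE zn addNr cmod0; apply.
  apply/eqP; rewrite -(@eqrXn2 _ n) ?cmod_ge0 ?ltW // -cmodX zn cmodN cmod_real gtr0_norm //.
have cr0 : coef_ratio n k l Q = 0.
  have Qn : Q`_n = 1 by rewrite coefQ eqxx (gtn_eqF n0) addr0.
  have Q0 : Q`_0 = (k ^+ n)%:C by rewrite coefQ (ltn_eqF n0) add0r.
  rewrite /coef_ratio m0 mulr0 subr0 Qn Q0.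
  by rewrite cmod1 mulr1 cmod_real gtr0_norm // subrr mul0r.
rewrite M'1 /deriv_bound M1 m0 cr0.
have -> : Q`_1 = 0 by rewrite coefQ (ltn_eqF n1) addr0.
have -> : Q`_(n - 1) = 0.
  by rewrite coefQ subn_eq0 (leqNgt n 1) n1 subn1 -{2}(prednK n0) (ltn_eqF (ltnSn _)) addr0.
rewrite cmod0 !(mulr0, mul0r, addr0) divfK // gt_eqF // addr_gt0 //.
Qed.

End Bound.

Local Open Scope complex_scope.

Theorem theorem2p2 (R : realType) (n : nat) (k : R) (hn : (2 <= n)%N) (hk : 1 <= k) :
  (forall P : {poly R[i]}, size P = n.+1 -> zeros_in_disk k P ->
     forall l : R, 0 <= l -> l < 1 ->
       maxmod 1 P^`() >= deriv_bound n k l P)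
  /\
  (let Q : {poly R[i]} := 'X^n + ((k ^+ n)%:C)%:P in
     size Q = n.+1 /\ zeros_in_disk k Q /\
     forall l : R, 0 <= l -> l < 1 ->
       maxmod 1 Q^`() = deriv_bound n k l Q).
Proof.
split=> [P sP zP l l0 l1|Q]; first exact: deriv_bound_le.
have [sQ zQ _] := deriv_bound_eq 0 hn hk.
by split=> //; split=> // l _ _; have [] := deriv_bound_eq l hn hk.
Qed.
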